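(* Let $V=\{1,\dots,d\}$, let $\mathbf X_V=(X_1,\dots,X_d)^T$ be a continuous random vector with joint probability density $f_V$, and for $K\subset V$ let $f_K$ denote the marginal density of $\mathbf X_K=(X_i)_{i\in K}$. Let a $k$-th order $t$-cherry junction tree on $V$ with cluster set $\mathcal C_{ch}$ and separator set $\mathcal S_{ch}$ be given, let $\nu_S$ be the number of clusters containing $S$, and let $$\widehat f_{V_{\mathcal{CS}}}(\mathbf x_V)=\frac{\prod_{K\in\mathcal C_{ch}}f_K(\mathbf x_K)}{\prod_{S\in\mathcal S_{ch}}\left(f_S(\mathbf x_S)\right)^{\nu_S-1}}$$ be the associated $k$-th order cherry-wine density. Then the Kullback-Leibler divergence between $f_V$ and the approximating density $\widehat f_{V_{\mathcal{CS}}}$ is $$KL\left(\widehat f_{V_{\mathcal{CS}}}(\mathbf x_V),f_V(\mathbf x_V)\right)=I(\mathbf X_V)-\left[\sum_{K\in\mathcal C_{ch}}I(\mathbf X_K)-\sum_{S\in\mathcal S_{ch}}(\nu_S-1)\,I(\mathbf X_S)\right].$$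
   Context: **$k$-th order $t$-cherry junction tree.** A $k$-th order $t$-cherry tree is a graph constructed recursively: (i) the complete graph on $k-1$ vertices is the smallest one; (ii) given a $k$-th order $t$-cherry tree, a new vertex $i_k$ is connected to all vertices $i_1,\dots,i_{k-1}$ of a complete subgraph on $k-1$ vertices of the existing graph, and the result is again a $k$-th order $t$-cherry tree; (iii) all are obtained in this way. The associated $k$-th order $t$-cherry junction tree on the vertex set $V$ has as clusters the $k$-element sets $\{i_1,\dots,i_{k-1},i_k\}$ arising in step (ii); these are the nodes of a tree satisfying the running intersection property (if a vertex lies in two clusters, it lies in every cluster on the tree path joining them), and the edges of this tree correspond to the separators $\{i_1,\dots,i_{k-1}\}$, which are the intersections of the linked clusters. $\mathcal C_{ch}$ and $\mathcal S_{ch}$ are the sets of clusters and of separators (each distinct separator is counted once in $\mathcal S_{ch}$). **Information quantities.** The Kullback-Leibler divergence is, in the paper's order of arguments, $$KL(\widehat f,f)=\int_{\mathbb R^d} f(\mathbf x)\log_2\frac{f(\mathbf x)}{\widehat f(\mathbf x)}\,d\mathbf x .$$ For $A\subset V$, $H(\mathbf X_A)=-\int f_A(\mathbf x_A)\log_2 f_A(\mathbf x_A)\,d\mathbf x_A$ is the differential entropy and $$I(\mathbf X_A)=\sum_{i\in A}H(X_i)-H(\mathbf X_A)=\int f_A(\mathbf x_A)\log_2\frac{f_A(\mathbf x_A)}{\prod_{i\in A}f_i(x_i)}\,d\mathbf x_A$$ is the information content of $\mathbf X_A$. The entropies involved are understood to exist and be finite. *)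

(* Defs.v *)
From HB Require Import structures.
From mathcomp Require Import all_boot all_order all_algebra.
From mathcomp Require Import all_classical all_reals all_analysis.

Set Implicit Arguments.
Unset Strict Implicit.
Unset Printing Implicit Defensive.

Import Order.TTheory GRing.Theory Num.Theory.
Import numFieldNormedType.Exports.

Section Combinatorics.
Variable T : finType.
Implicit Types (W S K : {set T}) (E C : {set {set T}}).

Definition complete_on E S : Prop :=
  {in S &, forall x y : T, x != y -> [set x; y]%SET \in E}.

(* [cherry_tree k W E C]: the graph with vertex set [W] and edges [E] (encoded
   as two-element sets) is a [k]-th order t-cherry tree admitting a
   construction in which [C] is the set of the [k]-element sets formed by each
   new vertex and the [k - 1] vertices it is attached to. *)
Inductive cherry_tree (k : nat) :
    {set T} -> {set {set T}} -> {set {set T}} -> Prop :=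
| CherryBase W :
    #|W| = (k - 1)%N ->
    cherry_tree k W
      [set e : {set T} | (e \subset W) && (#|e| == 2)]%SET finset.set0
| CherryStep W E C S v :
    cherry_tree k W E C ->
    S \subset W -> #|S| = (k - 1)%N -> complete_on E S -> v \notin W ->
    cherry_tree k (v |: W)%SET
      (E :|: [set [set v; s] | s in S])%SET ((v |: S) |: C)%SET.

End Combinatorics.

Section Trees.
Variable N : finType.
Implicit Types (C : {set N}) (t : rel N).

Definition simple_path t (x y : N) (p : seq N) : bool :=
  [&& path t x p, uniq (x :: p) & last x p == y].

Definition is_tree C t : Prop :=
  [/\ C != finset.set0,
      forall x y, t x y -> (x \in C) && (y \in C),
      symmetric t, irreflexive t &
      {in C &, forall x y, exists! p, simple_path t x y p}].

End Trees.

Section JunctionTree.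
Variable T : finType.
Implicit Types (S : {set T}) (C : {set {set T}}) (t : rel {set T}).

Definition running_intersection C t : Prop :=
  {in C &, forall A B : {set T}, forall p : seq {set T},
     simple_path t A B p -> {in p, forall D : {set T}, A :&: B \subset D}}.

Definition separators C t : {set {set T}} :=
  [set A :&: B | A in C, B in C & t A B]%SET.

(* The base complete graph of a t-cherry tree carries no cluster; nonemptiness
   of the node set of a tree rules out the graphs consisting of the base
   only. *)
Definition cherry_junction_tree (k : nat) C t : Prop :=
  [/\ exists E, cherry_tree k [set: T]%SET E C,
      is_tree C t, running_intersection C t &
      {in separators C t, forall S, #|S| = (k - 1)%N}].

Definition nu C S : nat := #|[set K in C | S \subset K]%SET|.

End JunctionTree.

Local Open Scope classical_set_scope.
Local Open Scope ring_scope.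
Local Open Scope ereal_scope.

Section LebesgueTuple.
Variable R : realType.

Definition cons_pair n (x : R * n.-tuple R) : n.+1.-tuple R :=
  [tuple of x.1 :: x.2].

Lemma measurable_cons_pair n : measurable_fun setT (@cons_pair n).
Proof. exact: measurable_cons. Qed.

Definition cons_measure n (m : {sigma_finite_measure set (n.-tuple R) -> \bar R})
    : set (n.+1.-tuple R) -> \bar R :=
  pushforward (@lebesgue_measure R \x m) (@cons_pair n).

Section ConsMeasure.
Variables (n : nat) (m : {sigma_finite_measure set (n.-tuple R) -> \bar R}).

Let cons_pushforward : {measure set (n.+1.-tuple R) -> \bar R} :=
  measure_function_pushforward__canonical__measure_function_Measure
    (@lebesgue_measure R \x m) (@measurable_cons_pair n).

Let cons_measure0 : cons_measure m set0 = 0.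
Proof. exact: (measure0 cons_pushforward). Qed.

Let cons_measure_ge0 A : 0 <= cons_measure m A.
Proof. exact: (measure_ge0 cons_pushforward). Qed.

Let cons_measure_sigma_additive : semi_sigma_additive (cons_measure m).
Proof. exact: (@measure_semi_sigma_additive _ _ _ cons_pushforward). Qed.

HB.instance Definition _ := isMeasure.Build _ _ _ (cons_measure m)
  cons_measure0 cons_measure_ge0 cons_measure_sigma_additive.

Let cons_measure_sigma_finite : sigma_finite setT (cons_measure m).
Proof.
have /sigma_finiteP[F [TF ndF Foo]] := sigma_finiteT (@lebesgue_measure R).
have /sigma_finiteP[G [TG ndG Goo]] := sigma_finiteT m.
exists (fun i => [set x | F i (thead x) /\ G i [tuple of behead x]]) => [|i].
  apply/seteqP; split=> // x _.
  have [i _ Fi] : (\bigcup_i F i) (thead x) by rewrite -TF.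
  have [j _ Gj] : (\bigcup_i G i) [tuple of behead x] by rewrite -TG.
  exists (maxn i j) => //; split.
    by move: (thead x) Fi; exact/subsetPset/ndF/leq_maxl.
  by move: [tuple of behead x] Gj; exact/subsetPset/ndG/leq_maxr.
have [mF Fi] := Foo i; have [mG Gi] := Goo i; split.
  apply: (measurableI (fun x : n.+1.-tuple R => F i (thead x))).
    by rewrite -[X in measurable X]setTI; exact: measurable_tnth.
  by rewrite -[X in measurable X]setTI; exact: measurable_behead.
rewrite /cons_measure /pushforward.
rewrite (_ : _ @^-1` _ = F i `*` G i); last first.
  apply/seteqP; split=> -[y z] /=; rewrite theadE;
    by rewrite (_ : [tuple of _] = z)//; exact/val_inj.
by rewrite product_measure1E// lte_mul_pinfty// ge0_fin_numE.
Qed.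

HB.instance Definition _ := Measure_isSigmaFinite.Build _ _ _ (cons_measure m)
  cons_measure_sigma_finite.

End ConsMeasure.

Fixpoint lebesgue_tuple n : {sigma_finite_measure set (n.-tuple R) -> \bar R} :=
  match n with
  | 0 => [the {sigma_finite_measure set _ -> \bar R} of \d_([tuple] : 0.-tuple R)]
  | n'.+1 => [the {sigma_finite_measure set _ -> \bar R} of
                cons_measure (lebesgue_tuple n')]
  end.

Lemma lebesgue_tuple_box n (A : 'I_n -> set R) :
  (forall i, measurable (A i)) ->
  lebesgue_tuple n [set x | forall i, A i (tnth x i)] =
  \prod_(i < n) @lebesgue_measure R (A i).
Proof.
elim: n A => [|n IHn] A mA /=.
  rewrite big_ord0 /= diracE mem_set//; by case.
rewrite big_ord_recl -(IHn (fun i => A (lift ord0 i)))//.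
rewrite -product_measure1E//; last first.
  rewrite (_ : mkset _ = \bigcap_(i in [set: 'I_n])
      ((fun x : n.-tuple R => tnth x i) @^-1` A (lift ord0 i))).
    apply: fin_bigcap_measurable => // i _.
    by rewrite -[X in measurable X]setTI; exact: measurable_tnth.
  by apply/seteqP; split=> x /= h i => [_|]; apply: h.
  exact: mA.
rewrite /cons_measure /pushforward; apply: (f_equal (product_measure1 _ _)).
apply/seteqP; split=> [[y z] /= h|[y z] [/= hy hz] i].
  split=> [|i]; first by have := h ord0.
  by have := h (lift ord0 i); rewrite /cons_pair tnthS.
case: (unliftP ord0 i) => [j|] ->; last by [].
by rewrite /cons_pair tnthS.
Qed.

End LebesgueTuple.

Section InformationTheory.
Variable R : realType.

Definition log2 (x : R) : R := (ln x / ln 2)%R.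

(* A density of the law of [X] with respect to Lebesgue measure on [R^n]. *)
Definition is_density (disp : measure_display) (Omega : measurableType disp)
    (P : probability Omega R) n (X : Omega -> n.-tuple R)
    (f : n.-tuple R -> R) : Prop :=
  [/\ measurable_fun [set: n.-tuple R] f,
      forall x, (0 <= f x)%R &
      forall B : set (n.-tuple R), measurable B ->
        P (X @^-1` B) = \int[lebesgue_tuple R n]_(x in B) (f x)%:E].

(* [ln 0 = 0], so the integrand vanishes where [f] does. *)
Definition entropy n (f : n.-tuple R -> R) : \bar R :=
  - \int[lebesgue_tuple R n]_x (f x * log2 (f x))%:E.

Definition finite_entropy n (f : n.-tuple R -> R) : Prop :=
  (lebesgue_tuple R n).-integrable setT (fun x => (f x * log2 (f x))%:E).

(* [p log2 (p / q)] with the conventions [0 log2 (0 / q) = 0] and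
   [p log2 (p / 0) = +oo] for [p > 0]. *)
Definition KL_integrand (p q : R) : \bar R :=
  if p == 0%R then 0
  else if q == 0%R then +oo
  else (p * log2 (p / q))%:E.

(* The approximating density comes first: [KL fhat f] integrates
   [f log2 (f / fhat)]. *)
Definition KL n (fhat f : n.-tuple R -> R) : \bar R :=
  \int[lebesgue_tuple R n]_x KL_integrand (f x) (fhat x).

End InformationTheory.

Section Marginals.
Variables (R : realType) (d : nat).
Implicit Types (K A S : {set 'I_d}) (C : {set {set 'I_d}}).

(* [x_K]: the coordinates of [x] indexed by [K], in increasing order; for
   [K = [set: 'I_d]] this is [x] itself, up to the equality
   [#|[set: 'I_d]| = d]. *)
Definition restr K (x : d.-tuple R) : #|K|.-tuple R :=
  [tuple tnth x (enum_val i) | i < #|K|].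

Variable f : forall K, #|K|.-tuple R -> R.

Definition joint_density (x : d.-tuple R) : R := f (restr [set: 'I_d]%SET x).

Definition information A : \bar R :=
  \sum_(i in A) entropy (@f [set i]%SET) - entropy (@f A).

Definition cherry_wine C (t : rel {set 'I_d}) (x : d.-tuple R) : R :=
  ((\prod_(K in C) f (restr K x)) /
   (\prod_(S in separators C t) f (restr S x) ^+ (nu C S - 1)))%R.

End Marginals.

(* Main.v *)
Require Import Defs.
From HB Require Import structures.
From mathcomp Require Import all_boot all_order all_algebra.
From mathcomp Require Import all_classical all_reals all_analysis.
From mathcomp Require Import measurable_realfun ring.

Set Implicit Arguments.
Unset Strict Implicit.
Unset Printing Implicit Defensive.

Import Order.TTheory GRing.Theory Num.Theory.
Import numFieldNormedType.Exports.

(** Where no density vanishes, the logarithm of the joint density over the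
    cherry-wine density is a linear combination of logarithms of marginal
    densities. A density composed with the vector it belongs to has minus the
    entropy as its mean logarithm ([density_entropy]), so the divergence equals
    - H(V) + sum_K H(K) - sum_S (nu_S - 1) H(S).

    Two points need an argument. First, the cherry-wine density may vanish
    where the joint density does not, and the integrand is infinite there. A
    random vector almost surely avoids the zeros of its own density, so the
    joint density is zero almost everywhere on the set where some marginal
    vanishes ([ae_joint_vanishes]), and these points do not contribute
    ([KL_mean]). All means are computed on the probability space, where the
    marginals of all dimensions live together and where finite entropy makes
    their logarithms integrable.

    Secondly, replacing the entropies by information contents introduces
    one-dimensional entropies, which must cancel: each vertex i must satisfy
    #{K : i in K} - sum_(S : i in S) (nu_S - 1) = 1 ([junction_tree_sum]).
    By the running intersection property, the clusters containing a set A form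
    a subtree, with one edge less than it has nodes. If A is a separator S,
    all these edges have the label S, because separators have equal
    cardinality; so S labels exactly nu_S - 1 edges of the junction tree. If A
    is {i}, the edges of the subtree are those whose label contains i, and
    sorting them by label gives the identity. *)

(** * Counting edges of junction trees *)

Section TreeEdges.
Variables (N : finType) (C : {set N}) (t : rel N).
Hypothesis C_tree : is_tree C t.

(** Rooting the tree at [r], every edge joins a node to its parent, the last
    node before it on the path from [r]; each node but [r] has one parent, and
    each edge is counted here once in each direction. *)
Lemma tree_card_edges :
  #|[set e : N * N | t e.1 e.2]%SET| = (#|C| - 1).*2.
Proof.
have [C0 tC tsym tirr tuniq] := C_tree.
have [r rC] := set0Pn _ C0.
have /choice[pth pthP] : forall x, exists p, x \in C -> simple_path t r x p /\
    (forall q, simple_path t r x q -> p = q).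
  move=> x; have [xC|_] := boolP (x \in C); last by exists [::].
  by have [p [pp pu]] := tuniq r x rC xC; exists p.
(* [child y x]: [y] is the parent of [x]. *)
pose child y x := [&& y \in C, x \in C & pth x == rcons (pth y) x].
have pth_last x : x \in C -> last r (pth x) = x.
  by move=> /pthP[/and3P[_ _ /eqP]].
have simple_rcons x y : x \in C -> t x y -> y \notin r :: pth x -> child x y.
  move=> xC txy yNp; have /andP[_ yC] := tC _ _ txy.
  have [/and3P[px ux lx] _] := pthP x xC.
  rewrite /child xC yC/=; apply/eqP; apply: (pthP y yC).2.
  apply/and3P; split; last by rewrite last_rcons.
    by rewrite rcons_path px (eqP lx).
  by rewrite -rcons_cons rcons_uniq yNp.
have edge_child x y : t x y -> child x y || child y x.
  move=> txy; have /andP[xC yC] := tC _ _ txy.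
  have [yp|] := boolP (y \in r :: pth x); last first.
    by move=> /(simple_rcons x y xC txy)->.
  have [xp|] := boolP (x \in r :: pth y); last first.
    by rewrite tsym in txy => /(simple_rcons y x yC txy)->; rewrite orbT.
  have xy : x != y by apply: contraTneq txy => ->; rewrite tirr.
  have [/and3P[px ux lx] uniqx] := pthP x xC.
  have [/and3P[py uy ly] uniqy] := pthP y yC.
  (* Were each endpoint on the path to the other one, each of the two paths
     would be a prefix of the other, the first one a strict prefix. *)
  have : size (pth y) < size (pth x).
    move: (px) (ux) (lx); case/splitPl: yp => p1 p2 lp1.
    rewrite cat_path -cat_cons cat_uniq last_cat.
    move=> /andP[pp1 pp2] /and3P[up1 _ _] lp2.
    have -> : pth y = p1.
      by apply: uniqy; rewrite /simple_path pp1 up1 lp1 eqxx.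
    rewrite size_cat -[ltnLHS]addn0 ltn_add2l lt0n size_eq0.
    apply: contra_neqN xy => p20.
    by move: lp2; rewrite (eqP p20) /= lp1 => /eqP.
  move: (py) (uy) (ly); case/splitPl: xp => p1 p2 lp1.
  rewrite cat_path -cat_cons cat_uniq => /andP[pp1 pp2] /and3P[up1 _ _] _.
  have -> : pth x = p1 by apply: uniqx; rewrite /simple_path pp1 up1 lp1 eqxx.
  by rewrite size_cat ltnNge leq_addr.
have child_edge x y : child x y -> t x y.
  move=> /and3P[xC yC /eqP pE].
  have [/and3P[+ _ _] _] := pthP y yC.
  by rewrite pE rcons_path pth_last// => /andP[].
have child_asym x y : child x y -> child y x = false.
  move=> /and3P[_ _ /eqP pE]; apply/negbTE/negP => /and3P[_ _ /eqP pE'].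
  move: (congr1 size pE); rewrite pE' !size_rcons => /eqP.
  by rewrite -addn2 -[eqbLHS]addn0 eqn_add2l.
have edgeE x y : t x y = (child x y + child y x) :> nat.
  have [txy|] := boolP (t x y).
    have [cxy|ncxy] := boolP (child x y); first by rewrite child_asym.
    by have := edge_child _ _ txy; rewrite (negbTE ncxy)/= => ->.
  move=> ntxy; suff [-> ->] : child x y = false /\ child y x = false by [].
  by split; apply/negbTE; apply: contra ntxy => /child_edge//; rewrite tsym.
have card_children x : \sum_y child y x = (x \in C) && (x != r).
  have [xC|xNC] := boolP (x \in C); last first.
    by rewrite big1// => y _; rewrite /child (negbTE xNC) andbF.
  have [->|xr] := eqVneq x r.
    have pr : pth r = [::] by apply: (pthP r rC).2; rewrite /simple_path/= eqxx.
    have rNil s : ([::] == rcons s r) = false by case: s.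
    by rewrite big1// => y _; rewrite /child pr rNil !andbF.
  have [/and3P[px ux lx] _] := pthP x xC.
  case/lastP E : (pth x) => [|q x'].
    by move: lx xr; rewrite E /= => /eqP->; rewrite eqxx.
  have xE : x' = x by move: lx; rewrite E last_rcons => /eqP.
  rewrite {x'}xE in E.
  have qC : last r q \in C.
    move: px; rewrite E rcons_path => /andP[_ tqx].
    by have /andP[] := tC _ _ tqx.
  have pq : pth (last r q) = q.
    apply: (pthP _ qC).2; rewrite /simple_path eqxx andbT.
    move: px ux; rewrite E rcons_path -rcons_cons rcons_uniq.
    by move=> /andP[-> _] /andP[_ ->].
  rewrite (bigD1 (last r q))//= big1 ?addn0.
    by rewrite /child qC xC pq E eqxx.
  move=> y yq; rewrite /child E; case: (boolP (y \in C)) => //= yC.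
  rewrite xC /= eqseq_rcons eqxx andbT.
  have [qE|//] := eqVneq q (pth y).
  by move: yq; rewrite qE pth_last// eqxx.
transitivity (\sum_x \sum_y t x y)%N.
  rewrite pair_bigA/= -sum1_card big_mkcond/=.
  by apply: eq_bigr => e _; rewrite inE; case: (t _ _).
under eq_bigr => x _ do
  (under eq_bigr => y _ do rewrite edgeE; rewrite big_split/=).
rewrite big_split/= exchange_big/= addnn; congr _.*2.
under eq_bigr do rewrite card_children.
rewrite (cardsD1 r) rC add1n subn1/= -sum1_card [RHS]big_mkcond/=.
by apply: eq_bigr => x _; rewrite !inE andbC; case: (_ && _).
Qed.

End TreeEdges.

Section JunctionTreeCounting.
Variables (T : finType) (C : {set {set T}}) (t : rel {set T}).
Hypotheses (C_tree : is_tree C t) (C_rip : running_intersection C t).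

(** The running intersection property makes the clusters containing [A] a
    connected part of the tree, since the path between two of them stays among
    them. *)
Lemma rip_subtree (A : {set T}) :
  [set K in C | A \subset K]%SET != finset.set0 ->
  is_tree [set K in C | A \subset K]%SET
    [rel K L | t K L && (A \subset K :&: L)].
Proof.
have [_ tC tsym tirr tuniq] := C_tree.
move=> D0; split=> //.
- move=> K L /= /andP[tKL]; rewrite finset.subsetI => /andP[AK AL].
  by rewrite !inE AK AL !andbT; exact: tC.
- by move=> K L /=; rewrite tsym finset.setIC.
- by move=> K /=; rewrite tirr.
move=> K L; rewrite !inE => /andP[KC AK] /andP[LC AL].
have [p [pp pu]] := tuniq K L KC LC.
have pA : {in p, forall M : {set T}, A \subset M}.
  move=> M Mp; apply: fintype.subset_trans (C_rip KC LC pp Mp).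
  by rewrite finset.subsetI AK AL.
exists p; split.
  case/and3P: pp => pp up lp; apply/and3P; split=> //.
  elim: p K {pu up lp} pp AK pA {KC} => [//|M p IHp] K /= /andP[tKM pp] AK pA.
  have AM : A \subset M by apply: pA; rewrite mem_head.
  rewrite tKM finset.subsetI AK AM/=; apply: IHp => // M' M'p; apply: pA.
  by rewrite inE M'p orbT.
move=> q /and3P[pq uq lq]; apply: pu; apply/and3P; split=> //.
by apply: sub_path pq => M M' /= /andP[].
Qed.

Lemma card_edges_above (A : {set T}) :
  [set K in C | A \subset K]%SET != finset.set0 ->
  #|[set e : {set T} * {set T} | t e.1 e.2 && (A \subset e.1 :&: e.2)]%SET| =
  (nu C A - 1).*2.
Proof. by move=> D0; rewrite -(tree_card_edges (rip_subtree D0)). Qed.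

Variable k : nat.
Hypothesis sep_card : {in separators C t, forall S : {set T}, #|S| = k}.

Lemma edge_separator (K L : {set T}) : t K L -> K :&: L \in separators C t.
Proof.
have [_ tC _ _ _] := C_tree.
move=> tKL; have /andP[KC LC] := tC _ _ tKL.
by apply/finset.imset2P; exists K L => //; rewrite inE LC.
Qed.

Lemma separator_edge (S : {set T}) : S \in separators C t ->
  exists K L, [/\ K \in C, L \in C, t K L & S = K :&: L].
Proof.
by move=> /finset.imset2P[K L KC]; rewrite inE => /andP[LC tKL] ->; exists K, L.
Qed.

Lemma separator_above (S : {set T}) : S \in separators C t ->
  [set K in C | S \subset K]%SET != finset.set0.
Proof.
move=> /separator_edge[K [L [KC _ _ ->]]]; apply/set0Pn; exists K.
by rewrite inE KC subsetIl.
Qed.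

Lemma nu_separator_gt0 (S : {set T}) : S \in separators C t -> 0 < nu C S.
Proof. by move=> /separator_above; rewrite card_gt0. Qed.

(** All separators have the same cardinality, so an edge between two clusters
    containing a separator [S] has label [S] itself and not a larger one. This
    is why the exponent [nu C S - 1], which counts clusters, is the multiplicity
    of [S] as an edge label. *)
Lemma card_edges_separator (S : {set T}) : S \in separators C t ->
  #|[set e : {set T} * {set T} | t e.1 e.2 && (e.1 :&: e.2 == S)]%SET| =
  (nu C S - 1).*2.
Proof.
move=> SS; rewrite -card_edges_above; last exact: separator_above.
apply: eq_card => -[K L]; rewrite !inE/=; case: (boolP (t K L)) => //= tKL.
rewrite eq_sym eqEcard.
by rewrite (sep_card SS) (sep_card (edge_separator tKL)) leqnn andbT.
Qed.

(** Both sides count, up to the factor two of orientation, the edges of the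
    subtree of the clusters containing [A]; the left one sorts them by label. *)
Lemma sum_nu_separators (A : {set T}) :
  [set K in C | A \subset K]%SET != finset.set0 ->
  \sum_(S in separators C t | A \subset S) (nu C S - 1) = nu C A - 1.
Proof.
move=> D0; apply: double_inj; rewrite -(card_edges_above D0).
rewrite -!muln2 big_distrl/=.
under eq_bigr => S /andP[SS _] do
  rewrite muln2 -(card_edges_separator SS) -sum1_card.
rewrite (exchange_big_dep
  [pred e | t e.1 e.2 && (A \subset e.1 :&: e.2)])/=; last first.
  by move=> S e /andP[_ AS]; rewrite inE => /andP[-> /eqP->].
rewrite -sum1_card; apply: eq_big => [e|e]; first by rewrite !inE.
move=> /andP[te Ae].
rewrite (big_pred1 (e.1 :&: e.2)) => [//|S]; rewrite inE te /= [RHS]eq_sym.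
by case: eqP => [<-|]; rewrite ?andbF// edge_separator// Ae.
Qed.

End JunctionTreeCounting.

(** The first vertex is attached to [k - 1] vertices of a graph with [k - 1]
    vertices, hence to all of them, so the first cluster absorbs the base. *)
Lemma cherry_tree_cover (T : finType) k (W : {set T}) E C :
  cherry_tree k W E C -> (C = finset.set0 /\ #|W| = (k - 1)%N) \/
  finset.cover C = W.
Proof.
elim=> [W' cW|W' E' C' S v _ IH SW cS _ _]; first by left.
right; rewrite /finset.cover finset.bigcup_setU big_set1.
case: IH => [[-> cW]|cW].
  rewrite big_set0 finset.setU0; congr (_ |: _).
  by apply/eqP; rewrite eqEcard SW cS cW leqnn.
rewrite -cW in SW *; rewrite -finset.setUA; congr (_ :|: _).
exact/finset.setUidPr.
Qed.

(** The coefficient of [h i] on the left is the number of clusters containing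
    [i] minus the number of edges between such clusters: these clusters form a
    nonempty subtree, so the difference is one. *)
Lemma junction_tree_sum (T : finType) (C : {set {set T}}) t k
    (V : comPzRingType) (h : T -> V) :
  cherry_junction_tree k C t ->
  (\sum_(K in C) \sum_(i in K) h i -
   \sum_(S in separators C t) ((nu C S)%:R - 1) * \sum_(i in S) h i =
   \sum_i h i)%R.
Proof.
move=> [[E Ecov] Ct rip sc].
have covC i : [set K in C | [set i]%SET \subset K]%SET != finset.set0.
  have [C0 _ _ _ _] := Ct.
  have [[C0' _]|/setP/(_ i)] := cherry_tree_cover Ecov.
    by rewrite C0' eqxx in C0.
  rewrite finset.in_setT => /finset.bigcupP[K KC iK]; apply/set0Pn; exists K.
  by rewrite inE KC finset.sub1set.
rewrite (exchange_big_dep predT)//=.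
have nu1 S : S \in separators C t -> ((nu C S)%:R - 1 = (nu C S - 1)%:R :> V)%R.
  by move=> SS; rewrite natrB// (nu_separator_gt0 SS).
under [X in (_ - X)%R]eq_bigr => S SS do rewrite (nu1 S SS) big_distrr/=.
rewrite [X in (_ - X)%R](exchange_big_dep predT)//= -sumrB.
apply: eq_bigr => i _.
rewrite sumr_const (_ : #|_| = nu C [set i]%SET); last first.
  by apply: eq_card => K; rewrite !inE finset.sub1set.
rewrite -big_distrl/= -natr_sum -[X in (X - _)%R]mulr_natl -mulrBl.
rewrite (_ : (\sum_(S in _ | _) _)%N = (nu C [set i]%SET - 1)%N); last first.
  rewrite -(sum_nu_separators Ct rip sc (covC i)).
  by apply: eq_bigl => S; rewrite finset.sub1set.
by rewrite natrB ?card_gt0 ?covC// opprB addrC subrK mul1r.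
Qed.

Local Open Scope classical_set_scope.
Local Open Scope ring_scope.
Local Open Scope ereal_scope.

(** * Change of variables along a density *)

Lemma measurable_log2 (R : realType) : measurable_fun [set: R] (@log2 R).
Proof. by apply: measurable_funM => //; exact: measurable_ln. Qed.

Section Density.
Context (R : realType) (disp : measure_display) (Omega : measurableType disp)
  (P : probability Omega R) (n : nat) (X : {RV P >-> n.-tuple R})
  (f : n.-tuple R -> R).
Hypothesis Xf : is_density P X f.
Let mu := lebesgue_tuple R n.

(** The density [f] agrees almost everywhere with the Radon-Nikodym derivative
    of the law of [X], for which the change of measure is available. *)
Lemma ge0_density_change (g : n.-tuple R -> \bar R) :
  measurable_fun setT g -> (forall x, 0 <= g x) ->
  \int[mu]_x (g x * (f x)%:E) = \int[P]_w g (X w).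
Proof.
have [mf f0 fP] := Xf.
move=> mg g0; rewrite -ge0_integral_distribution//.
have mEf : measurable_fun setT (EFin \o f) by exact/measurable_EFinP.
have dom : distribution P X `<< mu.
  apply/null_content_dominatesP => A mA muA0.
  rewrite /distribution /pushforward fP//.
  by apply: null_set_integral => //; exact: measurable_funTS.
rewrite -(Radon_Nikodym_SigmaFinite.change_of_variables dom)//.
have mRN := Radon_Nikodym_SigmaFinite.f_integrable dom.
apply: ae_eq_integral => //.
- exact: emeasurable_funM.
- by apply: emeasurable_funM => //; exact: measurable_int mRN.
suff [N [mN N0 sub]] : ae_eq mu setT
    (Radon_Nikodym_SigmaFinite.f (distribution P X) mu) (EFin \o f).
  exists N; split=> // x /= xN; apply: sub => /= h; apply: xN => _.
  by rewrite h.
apply: integral_ae_eq => // A _ mA.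
by rewrite -Radon_Nikodym_SigmaFinite.f_integral// -fP.
Qed.

(** Finite entropy is Lebesgue integrability on a space that depends on the
    marginal; on [Omega] the logarithms of all the marginals can be added up. *)
Lemma density_integrable (g : n.-tuple R -> R) : measurable_fun setT g ->
  mu.-integrable setT (fun x => (f x * g x)%:E) ->
  P.-integrable setT (fun w => (g (X w))%:E).
Proof.
have [mf f0 fP] := Xf.
move=> mg /integrableP[_ fg]; apply/integrableP; split.
  by apply/measurable_EFinP; exact: measurableT_comp.
rewrite -(ge0_density_change (g := fun x => `|(g x)%:E|))//.
  move: fg; congr (_ < _); apply: eq_integral => x _.
  by rewrite /= -EFinM normrM mulrC (ger0_norm (f0 x)).
by apply/measurable_EFinP; exact: measurableT_comp.
Qed.

Lemma density_expectation (g : n.-tuple R -> R) : measurable_fun setT g ->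
  \int[mu]_x (f x * g x)%:E = \int[P]_w (g (X w))%:E.
Proof.
have [mf f0 fP] := Xf.
move=> mg; have mEg : measurable_fun setT (EFin \o g) by exact/measurable_EFinP.
rewrite integralE [RHS]integralE; congr (_ - _).
- transitivity (\int[P]_w (EFin \o g)^\+ (X w)); last first.
    by apply: eq_integral => w _; rewrite !funepos.unlock.
  rewrite -ge0_density_change//; last exact: measurable_funepos.
  apply: eq_integral => x _; rewrite !funepos.unlock/=.
  by rewrite -!EFin_max -EFinM mulrC maxr_pMl// mul0r.
- transitivity (\int[P]_w (EFin \o g)^\- (X w)); last first.
    by apply: eq_integral => w _; rewrite !funeneg.unlock.
  rewrite -ge0_density_change//; last exact: measurable_funeneg.
  apply: eq_integral => x _; rewrite !funeneg.unlock/=.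
  by rewrite -!EFin_max -EFinM mulrC maxr_pMl// mul0r mulNr.
Qed.

Lemma density_entropy : finite_entropy f ->
  P.-integrable setT (fun w => (log2 (f (X w)))%:E) /\
  \int[P]_w (log2 (f (X w)))%:E = - entropy f.
Proof.
have [mf f0 fP] := Xf.
have mlf : measurable_fun setT (fun x => log2 (f x)).
  by apply: measurableT_comp mf; exact: measurable_log2.
move=> fin; split; first exact: (density_integrable mlf fin).
by rewrite -(density_expectation mlf) /entropy oppeK.
Qed.

Lemma density_zero_null (N : set (n.-tuple R)) : measurable N ->
  P (X @^-1` N) = 0 -> {ae mu, forall x, N x -> f x = 0%R}.
Proof.
have [mf f0 fP] := Xf.
move=> mN PN0.
have mEf : measurable_fun N (EFin \o f).
  by apply: measurable_funTS; exact/measurable_EFinP.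
have : \int[mu]_(x in N) `|(EFin \o f) x| = 0.
  rewrite -PN0 fP//; apply: eq_integral => x _.
  by rewrite gee0_abs// lee_fin.
move=> /(ae_eq_integral_abs mu mN mEf)[Z [mZ Z0 sub]].
exists Z; split => // x /= xZ; apply: sub => /= h; apply: xZ => Nx.
by have [] := h Nx.
Qed.

(** This probability is the integral of [f] over the zeros of [f]. *)
Lemma density_vanishing_null : P (X @^-1` [set x | f x = 0%R]) = 0.
Proof.
have [mf f0 fP] := Xf.
rewrite fP; last first.
  by rewrite -[X in measurable X]setTI; exact: (mf measurableT [set 0%R]).
by rewrite integral0_eq// => x /= ->.
Qed.

End Density.

(** * Means of linear combinations *)

Section Mean.
Context (R : realType) (disp : measure_display) (Omega : measurableType disp)
  (P : probability Omega R).

(** Integrability is part of the notion because means of functions that are not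
    integrable do not add up. *)
Definition has_mean (g : Omega -> R) (r : R) : Prop :=
  P.-integrable setT (EFin \o g) /\ \int[P]_w (g w)%:E = r%:E.

Lemma has_mean_add g1 g2 r1 r2 : has_mean g1 r1 -> has_mean g2 r2 ->
  has_mean (fun w => (g1 w + g2 w)%R) (r1 + r2)%R.
Proof.
move=> [i1 e1] [i2 e2]; split; last by rewrite EFinD -e1 -e2 -integralD_EFin.
by apply: eq_integrable (integrableD measurableT i1 i2).
Qed.

Lemma has_mean_scale (c : R) g r : has_mean g r ->
  has_mean (fun w => (c * g w)%R) (c * r)%R.
Proof.
move=> [i1 e1]; split; last by rewrite EFinM -e1 -integralZl.
by apply: eq_integrable (integrableZl measurableT c i1).
Qed.

Lemma has_mean_sub g1 g2 r1 r2 : has_mean g1 r1 -> has_mean g2 r2 ->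
  has_mean (fun w => (g1 w - g2 w)%R) (r1 - r2)%R.
Proof.
move=> g1r1 /(has_mean_scale (-1)) g2r2; rewrite -[(- r2)%R]mulN1r.
by under eq_fun do rewrite -[(- g2 _)%R]mulN1r; exact: has_mean_add.
Qed.

Lemma has_mean_sum (I : Type) (s : seq I) (Q : pred I) (g : I -> Omega -> R)
    (r : I -> R) : (forall i, Q i -> has_mean (g i) (r i)) ->
  has_mean (fun w => (\sum_(i <- s | Q i) g i w)%R) (\sum_(i <- s | Q i) r i)%R.
Proof.
move=> gr; elim: s => [|i s IHs].
  under eq_fun do rewrite big_nil; rewrite big_nil.
  by split; [exact: integrable0|exact: integral0].
under eq_fun do rewrite big_cons; rewrite big_cons.
by case: (boolP (Q i)) => // /gr gri; exact: has_mean_add.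
Qed.

End Mean.

(** * Logarithms and measurability of the divergence integrand *)

Section KLIntegrand.
Variable R : realType.
Implicit Types p q : R.

Lemma log2M p q : (0 < p)%R -> (0 < q)%R -> log2 (p * q) = (log2 p + log2 q)%R.
Proof. by move=> p0 q0; rewrite /log2 lnM ?posrE// mulrDl. Qed.

Lemma log2_div p q : (0 < p)%R -> (0 < q)%R ->
  log2 (p / q) = (log2 p - log2 q)%R.
Proof. by move=> p0 q0; rewrite /log2 ln_div ?posrE// mulrBl. Qed.

Lemma log2X p m : (0 < p)%R -> log2 (p ^+ m) = (m%:R * log2 p)%R.
Proof. by move=> p0; rewrite /log2 lnXn// mulrA -[(ln p *+ m)%R]mulr_natl. Qed.

Lemma log2_prod (I : Type) (s : seq I) (Q : pred I) (F : I -> R) :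
  (forall i, Q i -> (0 < F i)%R) ->
  log2 (\prod_(i <- s | Q i) F i) = (\sum_(i <- s | Q i) log2 (F i))%R.
Proof.
move=> F0; suff [] : (0 < \prod_(i <- s | Q i) F i)%R /\
  log2 (\prod_(i <- s | Q i) F i) = (\sum_(i <- s | Q i) log2 (F i))%R by [].
apply: (big_rec2 (fun x y => (0 < x)%R /\ log2 x = y)) => [|i y x Qi [x0 <-]].
  by rewrite /log2 ln1 mul0r.
by rewrite mulr_gt0 ?F0// log2M ?F0.
Qed.

Context (disp : measure_display) (T : measurableType disp).

(** On nonnegative reals, including [0], where both vanish, the inverse is the
    real power of exponent [-1], and real powers are measurable. *)
Lemma measurable_nneg_inv (g : T -> R) : measurable_fun setT g ->
  (forall x, (0 <= g x)%R) -> measurable_fun setT (fun x => (g x)^-1%R).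
Proof.
move=> mg g0; rewrite (_ : (fun x => _) = (fun x => g x `^ (-1))%R); last first.
  by apply/funext => x; rewrite powR_inv1.
by apply: (measurableT_comp (f := fun y : R => (y `^ (-1))%R)).
Qed.

Lemma measurable_KL_integrand (f g : T -> R) :
  measurable_fun setT f -> measurable_fun setT g -> (forall x, (0 <= g x)%R) ->
  measurable_fun setT (fun x => KL_integrand (f x) (g x)).
Proof.
move=> mf mg g0; rewrite /KL_integrand.
apply: measurable_fun_ifT => //; first exact: measurable_fun_eqr.
apply: measurable_fun_ifT => //; first exact: measurable_fun_eqr.
apply/measurable_EFinP; apply: measurable_funM => //.
apply: measurableT_comp (@measurable_log2 R) _.
by apply: measurable_funM => //; exact: measurable_nneg_inv.
Qed.

End KLIntegrand.

(** * Restriction to a set of coordinates *)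

Section Restriction.
Context (R : realType) (d : nat).

Lemma measurable_restr (K : {set 'I_d}) :
  measurable_fun setT (@restr R d K).
Proof.
apply/measurable_fun_tnthP => i.
rewrite (_ : _ \o _ = (fun x => tnth x (enum_val i))).
  exact: measurable_tnth.
by apply/funext => x /=; rewrite tnth_mktuple.
Qed.

(** Restricting to all coordinates only changes the type of the tuple, along the
    propositional equality of [d] and the cardinality of the full set. *)
Lemma restr_full (e : d = #|[set: 'I_d]%SET|) (x : d.-tuple R) :
  restr [set: 'I_d]%SET x = tcast e x.
Proof.
apply: eq_from_tnth => i; rewrite tnth_mktuple tcastE; congr tnth.
apply: val_inj => /=.
have c := etrans (cardsT 'I_d) (card_ord d).
rewrite (enum_val_nth (cast_ord c i)) enum_setT -enumT nth_enum_ord//.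
exact: ltn_ord (cast_ord c i).
Qed.

Lemma density_tcast (disp : measure_display) (Omega : measurableType disp)
    (P : probability Omega R) m n (e : n = m) (X : Omega -> n.-tuple R)
    (f : m.-tuple R -> R) :
  is_density P (fun w => tcast e (X w)) f ->
  is_density P X (fun x => f (tcast e x)).
Proof. by case: _ / e f => f; under eq_fun do rewrite tcast_id. Qed.

Lemma joint_density_full (disp : measure_display) (Omega : measurableType disp)
    (P : probability Omega R) (X : Omega -> d.-tuple R)
    (f : forall K : {set 'I_d}, #|K|.-tuple R -> R) :
  is_density P (fun w => restr [set: 'I_d]%SET (X w)) (@f [set: 'I_d]%SET) ->
  is_density P X (joint_density f).
Proof.
have e : d = #|[set: 'I_d]%SET| by rewrite cardsT card_ord.
have restrE : @restr R d [set: 'I_d]%SET = tcast e.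
  by apply/funext; exact: restr_full.
by rewrite /joint_density restrE; exact: density_tcast.
Qed.

End Restriction.

(** * Divergence of the cherry-wine density *)

Section CherryWine.
Context (R : realType) (disp : measure_display)
  (Omega : measurableType disp) (P : probability Omega R)
  (d : nat) (X : {RV P >-> d.-tuple R})
  (f : forall K : {set 'I_d}, #|K|.-tuple R -> R).
Hypothesis f_density : forall K : {set 'I_d},
  is_density P (fun w => restr K (X w)) (@f K).
Implicit Types (K S A : {set 'I_d}) (C : {set {set 'I_d}}).

HB.instance Definition _ K :=
  isMeasurableFun.Build _ _ _ _ (@restr R d K) (@measurable_restr R d K).

Definition margin K : {RV P >-> #|K|.-tuple R} :=
  [the {mfun _ >-> _} of @restr R d K \o X].

Let marg K (x : d.-tuple R) : R := f (restr K x).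

Lemma measurable_marg K : measurable_fun setT (marg K).
Proof.
have [mf _ _] := f_density K.
exact: measurableT_comp mf (@measurable_restr R d K).
Qed.

Lemma marg_ge0 K x : (0 <= marg K x)%R.
Proof. by have [_ + _] := f_density K; exact. Qed.

Lemma mean_log2_margin A : finite_entropy (@f A) ->
  has_mean P (fun w => log2 (marg A (X w))) (- fine (entropy (@f A)))%R.
Proof.
move=> fin; have [ilog elog] :=
  @density_entropy _ _ _ P _ (margin A) _ (f_density A) fin.
by split => //; rewrite elog EFinN fineK// /entropy fin_numN integrable_fin_num.
Qed.

(** [X] almost surely avoids the set where a given marginal vanishes, as the
    restriction of [X] avoids the zeros of its own density; so the joint density
    is zero almost everywhere on that set. *)
Lemma ae_joint_vanishes K :
  {ae lebesgue_tuple R d, forall x, marg K x = 0%R -> joint_density f x = 0%R}.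
Proof.
apply: (density_zero_null (joint_density_full (f_density _))
  (N := [set x | marg K x = 0%R])).
  rewrite -[X in measurable X]setTI.
  exact: (@measurable_marg K measurableT [set 0%R]).
exact: (@density_vanishing_null _ _ _ P _ (margin K) _ (f_density K)).
Qed.

(** The logarithm of the joint density over the cherry-wine density, extended to
    the points where some of these densities vanish. *)
Definition log_ratio C t x : R :=
  (log2 (joint_density f x) - (\sum_(K in C) log2 (marg K x) -
    \sum_(S in separators C t) (nu C S - 1)%:R * log2 (marg S x)))%R.

Lemma KL_integrand_log_ratio C t x :
  (forall K, marg K x = 0%R -> joint_density f x = 0%R) ->
  KL_integrand (joint_density f x) (cherry_wine f C t x) =
  (joint_density f x * log_ratio C t x)%:E.
Proof.
move=> f0; rewrite /KL_integrand.
have [->|fV0] := eqVneq (joint_density f x) 0%R.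
  by rewrite mul0r.
have fK_gt0 K : (0 < marg K x)%R.
  by rewrite lt_neqAle marg_ge0 andbT eq_sym; apply: contra_neq fV0; exact: f0.
have N_gt0 : (0 < \prod_(K in C) marg K x)%R by exact: prodr_gt0.
have D_gt0 : (0 < \prod_(S in separators C t) marg S x ^+ (nu C S - 1))%R.
  by apply: prodr_gt0 => S _; rewrite exprn_gt0.
have fhat_gt0 : (0 < cherry_wine f C t x)%R by rewrite divr_gt0.
rewrite gt_eqF// log2_div//; last exact: fK_gt0 [set: 'I_d]%SET.
rewrite /cherry_wine log2_div// (@log2_prod _ _ _ _ (marg ^~ x))//.
rewrite (@log2_prod _ _ _ _
  (fun S => (marg S x ^+ (nu C S - 1))%R)); last first.
  by move=> S _; rewrite exprn_gt0.
congr (_ * (_ - (_ - _)))%:E; apply: eq_bigr => S _; exact: log2X.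
Qed.

Lemma measurable_joint : measurable_fun setT (joint_density f).
Proof. exact: measurable_marg. Qed.

Lemma measurable_cherry_wine C t : measurable_fun setT (cherry_wine f C t).
Proof.
rewrite /cherry_wine; apply: measurable_funM.
  under eq_fun do rewrite -big_filter.
  by apply: measurable_prod => K _; exact: measurable_marg.
apply: measurable_nneg_inv => [|x].
  under eq_fun do rewrite -big_filter.
  apply: measurable_prod => S _; apply: measurable_funX; exact: measurable_marg.
by apply: prodr_ge0 => S _; rewrite exprn_ge0// marg_ge0.
Qed.

Lemma cherry_wine_ge0 C t x : (0 <= cherry_wine f C t x)%R.
Proof.
apply: divr_ge0; apply: prodr_ge0 => K _; first exact: marg_ge0.
by rewrite exprn_ge0// marg_ge0.
Qed.

Lemma measurable_log_ratio C t : measurable_fun setT (log_ratio C t).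
Proof.
have mlog K : measurable_fun setT (fun x => log2 (marg K x)).
  by apply: measurableT_comp (@measurable_marg K); exact: measurable_log2.
apply: measurable_funB; first exact: mlog.
apply: measurable_funB; under eq_fun do rewrite -big_filter;
  apply: measurable_sum => K; first exact: mlog.
by apply: measurable_funM => //; exact: mlog.
Qed.

(** The infinite values of the divergence integrand lie where the joint density
    is positive while some marginal vanishes, which is a Lebesgue-null set. *)
Lemma KL_mean C t : KL (cherry_wine f C t) (joint_density f) =
  \int[P]_w (log_ratio C t (X w))%:E.
Proof.
rewrite -(density_expectation (joint_density_full (f_density _)))//; last first.
  exact: measurable_log_ratio.
apply: ae_eq_integral => //.
- apply: measurable_KL_integrand; [exact: measurable_joint|
    exact: measurable_cherry_wine|exact: cherry_wine_ge0].
- apply/measurable_EFinP; apply: measurable_funM; first exact: measurable_joint.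
  exact: measurable_log_ratio.
have : {ae lebesgue_tuple R d,
    forall x K, marg K x = 0%R -> joint_density f x = 0%R}.
  by apply: filter_forall => K; exact: ae_joint_vanishes.
by apply: filterS => x h _; exact: KL_integrand_log_ratio.
Qed.

Lemma informationE A : finite_entropy (@f A) ->
  (forall i : 'I_d, finite_entropy (@f [set i]%SET)) ->
  information f A = (\sum_(i in A) fine (entropy (@f [set i]%SET)) -
    fine (entropy (@f A)))%:E.
Proof.
have fin B : finite_entropy (@f B) ->
    (fine (entropy (@f B)))%:E = entropy (@f B).
  by move=> fB; rewrite fineK// /entropy fin_numN integrable_fin_num.
move=> fA f1; rewrite /information EFinB fin// -sumEFin; congr (_ - _).
by apply: eq_bigr => i _; rewrite fin.
Qed.

End CherryWine.

Theorem theorem8 (R : realType) (disp : measure_display)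
    (Omega : measurableType disp) (P : probability Omega R)
    (d k : nat) (X : {RV P >-> d.-tuple R})
    (f : forall K : {set 'I_d}, #|K|.-tuple R -> R)
    (C : {set {set 'I_d}}) (t : rel {set 'I_d})
    (k_gt0 : (0 < k)%N)
    (f_density : forall K : {set 'I_d},
       is_density P (fun w => restr K (X w)) (@f K))
    (C_tree : cherry_junction_tree k C t)
    (HV_fin : finite_entropy (@f [set: 'I_d]%SET))
    (H1_fin : forall i : 'I_d, finite_entropy (@f [set i]%SET))
    (HC_fin : forall K : {set 'I_d}, K \in C -> finite_entropy (@f K))
    (HS_fin : forall S : {set 'I_d}, S \in separators C t ->
       finite_entropy (@f S)) :
  KL (cherry_wine f C t) (joint_density f) =
  information f [set: 'I_d]%SET -
  (\sum_(K in C) information f K -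
   \sum_(S in separators C t) ((nu C S)%:R - 1)%R%:E * information f S).
Proof.
pose h A := fine (entropy (@f A)).
have nu_gt0 S : S \in separators C t -> (0 < nu C S)%N.
  by case: C_tree => _ Ct _ _; exact: nu_separator_gt0.
have [_ meanL] : has_mean P (fun w => log_ratio f C t (X w))
   (- h [set: 'I_d]%SET - (\sum_(K in C) - h K -
      \sum_(S in separators C t) (nu C S - 1)%:R * - h S)).
  apply: has_mean_sub; first exact: mean_log2_margin.
  apply: has_mean_sub; apply: has_mean_sum => A /= AP.
    by apply: mean_log2_margin => //; exact: HC_fin.
  by apply: has_mean_scale; apply: mean_log2_margin => //; exact: HS_fin.
rewrite (KL_mean f_density) meanL informationE//.
rewrite (eq_bigr (fun K : {set 'I_d} =>
    (\sum_(i in K) h [set i]%SET - h K)%R%:E)); last first.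
  by move=> K KC; rewrite informationE//; exact: HC_fin.
rewrite [X in _ - (_ - X)](eq_bigr (fun S : {set 'I_d} =>
    (((nu C S)%:R - 1) * (\sum_(i in S) h [set i]%SET - h S))%R%:E));
  last first.
  by move=> S SS; rewrite informationE//; exact: HS_fin.
rewrite !sumEFin -!EFinB; congr _%:E.
(* Only the joint, cluster and separator entropies are left once the
   one-dimensional entropies cancel by [junction_tree_sum]. *)
have -> : (\sum_(S in separators C t) ((nu C S)%:R - 1) *
      (\sum_(i in S) h [set i]%SET - h S) =
    \sum_(S in separators C t)
      ((nu C S)%:R - 1) * (\sum_(i in S) h [set i]%SET) -
    \sum_(S in separators C t) ((nu C S)%:R - 1) * h S)%R.
  by rewrite -sumrB; apply: eq_bigr => S _; rewrite mulrBr.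
have -> : (\sum_(S in separators C t) (nu C S - 1)%:R * - h S =
    - \sum_(S in separators C t) ((nu C S)%:R - 1) * h S)%R.
  rewrite -sumrN; apply: eq_bigr => S SS.
  by rewrite mulrN natrB// nu_gt0.
have -> : (\sum_(i in [set: 'I_d]%SET) h [set i]%SET = \sum_i h [set i]%SET)%R.
  by apply: eq_bigl => i; rewrite inE.
rewrite -(junction_tree_sum (fun i => h [set i]%SET) C_tree) sumrB sumrN.
rewrite -/(h _); ring.
Qed.
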